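(* Let $X\in\mathbb R^{d\times n}$ and let $\mathbf u^0\in\mathbb R^d$ with $\|\mathbf u^0\|=1$ and $X^\top\mathbf u^0\neq 0$. Let $\{\mathbf u^k\}$ be generated by $$\mathbf s^k=\operatorname{sgn}(X^\top\mathbf u^k)\in\mathbb R^n,\qquad \mathbf u^{k+1}=X\mathbf s^k/\|X\mathbf s^k\|,\qquad k=0,1,2,\ldots$$ Then the algorithm converges in finitely many steps to a FOC point: there exist an index $k_0$ and a unit vector $\mathbf u^*\in\mathbb R^d$ such that $\mathbf u^k=\mathbf u^*$ for all $k\ge k_0$, and $\mathbf u^*$ is a FOC point of the problem $\max_{\|\mathbf u\|=1}\|X^\top\mathbf u\|_1$.
   Context: $\|\cdot\|$ is the Euclidean norm, $\|\cdot\|_1$ the $L_1$-norm. $\operatorname{sgn}(x)=x/|x|$ if $x\ne0$, $\operatorname{sgn}(0)=0$, applied entrywise. This is the case of projection dimension $K=1$ of the non-greedy algorithm for $L_1$-norm PCA. $\partial\|\mathbf v\|_1\big|_{\mathbf v=X^\top\mathbf u}$ is the set of $\mathbf s\in\mathbb R^n$ with $s_i=\operatorname{sgn}((X^\top\mathbf u)_i)$ if $(X^\top \mathbf u)_i\ne0$ and $s_i\in[-1,1]$ otherwise. A unit vector $\mathbf u\in\mathbb R^d$ is a FOC point if there is $\mathbf w\in X\,\partial\|\mathbf v\|_1\big|_{\mathbf v=X^\top\mathbf u}$ with $\langle\mathbf w,\mathbf u-\mathbf z\rangle\ge0$ for all $\mathbf z\in\mathbb R^d$ with $\|\mathbf z\|=1$.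 *)

(* Defs.v *)
From HB Require Import structures.
From mathcomp Require Import all_boot all_order all_algebra.
From mathcomp Require Import classical_sets reals.

Set Implicit Arguments.
Unset Strict Implicit.
Unset Printing Implicit Defensive.

Import Order.TTheory GRing.Theory Num.Theory.
Local Open Scope classical_set_scope.
Local Open Scope ring_scope.

Definition inner (R : realType) (m : nat) (x y : 'cV[R]_m) : R :=
  \sum_(i < m) x i 0 * y i 0.

(* MathComp-Analysis equips matrices with the sup norm, hence a separate
   Euclidean norm. *)
Definition enorm (R : realType) (m : nat) (x : 'cV[R]_m) : R :=
  Num.sqrt (\sum_(i < m) x i 0 ^+ 2).

Definition sgnv (R : realType) (m : nat) (x : 'cV[R]_m) : 'cV[R]_m :=
  map_mx Num.sg x.

(* The subdifferential of the L1-norm at v. *)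
Definition l1_subdiff (R : realType) (m : nat) (v : 'cV[R]_m) :
    set 'cV[R]_m :=
  [set s | forall i : 'I_m,
     if v i 0 != 0 then s i 0 = Num.sg (v i 0) else -1 <= s i 0 <= 1].

(* First-order critical points of max { ||X^T u||_1 : ||u|| = 1 }. *)
Definition FOC_point (R : realType) (d n : nat) (X : 'M[R]_(d, n))
    (u : 'cV[R]_d) : Prop :=
  enorm u = 1 /\
  exists2 w : 'cV[R]_d,
    [set X *m s | s in l1_subdiff (X^T *m u)] w &
    forall z : 'cV[R]_d, enorm z = 1 -> 0 <= inner w (u - z).

(* Main.v *)
(** Write [N k] for the norm of [X *m s k].  Since [s k.+1] maximizes
    [<s, X^T u k.+1>] over the cube, and by Cauchy-Schwarz,
    [N k = <X s_k, u_{k+1}> <= <X s_{k+1}, u_{k+1}> <= N k.+1].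
    Sign vectors are finitely many, so [N k.+1 = N k] for some [k].  The
    equality case of Cauchy-Schwarz then gives [u k.+2 = u k.+1], which is a
    fixed point of the iteration, and Cauchy-Schwarz makes it critical. *)
Require Import Defs.
From HB Require Import structures.
From mathcomp Require Import all_boot all_order all_algebra.
From mathcomp Require Import classical_sets reals.
From mathcomp Require Import ring.
Import Order.TTheory GRing.Theory Num.Theory.
Local Open Scope ring_scope.

(** By pigeonhole [g] repeats, say [g i = g j] with [i < j]. Monotonicity squeezes [F (g i.+1)]
    between the equal values [F (g i)] and [F (g j)], so the stall occurs at [i]. *)
Lemma monotone_finite_stalls {disp : Order.disp_t} {P : porderType disp}
    {T : finType} (F : T -> P) (g : nat -> T) :
  (forall k, (F (g k) <= F (g k.+1))%O) -> exists k, F (g k.+1) = F (g k).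
Proof.
move=> Fle; pose h (i : 'I_#|T|.+1) := g i.
have Fmono i j : (i <= j)%N -> (F (g i) <= F (g j))%O.
  elim: j => [|j IHj]; first by rewrite leqn0 => /eqP ->.
  rewrite leq_eqVlt => /predU1P[-> //|leij].
  exact: le_trans (IHj leij) (Fle j).
have stall i j : (i < j)%N -> g i = g j -> exists k, F (g k.+1) = F (g k).
  move=> ltij eqg; exists i; apply/le_anti; rewrite Fle andbT.
  by rewrite [X in (_ <= F X)%O]eqg Fmono.
have /injectivePn[i [j neqij eqg]] : ~~ injectiveb h.
  by apply/negP => /injectiveP/leq_card; rewrite card_ord ltnn.
by case: (ltngtP i j) neqij => [/stall|/stall|/val_inj -> /eqP //] H _;
  apply: H.
Qed.

Section Euclidean.
Context {R : realType}.

Lemma innerBr {m} (x y z : 'cV[R]_m) : inner x (y - z) = inner x y - inner x z.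
Proof.
by rewrite /inner -sumrB; apply: eq_bigr => i _; rewrite !mxE mulrBr.
Qed.

Lemma innerZr {m} a (x y : 'cV[R]_m) : inner x (a *: y) = a * inner x y.
Proof.
by rewrite /inner mulr_sumr; apply: eq_bigr => i _; rewrite mxE mulrCA.
Qed.

Lemma inner_mulmx {d n} (X : 'M[R]_(d, n)) (s : 'cV[R]_n) (u : 'cV[R]_d) :
  inner (X *m s) u = inner s (X^T *m u).
Proof.
have innerE m (x y : 'cV[R]_m) : inner x y = (x^T *m y) 0 0.
  by rewrite mxE; apply: eq_bigr => i _; rewrite mxE.
by rewrite !innerE trmx_mul mulmxA.
Qed.

Lemma enorm_ge0 {m} (x : 'cV[R]_m) : 0 <= enorm x.
Proof. exact: sqrtr_ge0. Qed.

Lemma enorm_sqr {m} (x : 'cV[R]_m) : enorm x ^+ 2 = inner x x.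
Proof.
by rewrite sqr_sqrtr //; apply: sumr_ge0 => i _; exact: sqr_ge0.
Qed.

Lemma enorm_eq0 {m} {x : 'cV[R]_m} : enorm x = 0 -> x = 0.
Proof.
move=> x0; have /eqP := enorm_sqr x; rewrite x0 expr0n /= eq_sym.
rewrite psumr_eq0 => [|i _]; last by rewrite -expr2 sqr_ge0.
move=> /allP xx0; apply/colP => i; have := xx0 i (mem_index_enum i).
by rewrite /= -expr2 sqrf_eq0 mxE => /eqP.
Qed.

Lemma enorm_normalize {m} (x : 'cV[R]_m) :
  0 < enorm x -> enorm ((enorm x)^-1 *: x) = 1.
Proof.
move=> x_gt0; rewrite /enorm.
under eq_bigr do rewrite mxE exprMn.
rewrite -mulr_sumr sqrtrM ?sqr_ge0 // sqrtr_sqr -/(enorm x).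
by rewrite ger0_norm ?invr_ge0 ?enorm_ge0 // mulVf ?gt_eqF.
Qed.

Lemma inner_normalize {m} (x : 'cV[R]_m) :
  0 < enorm x -> inner x ((enorm x)^-1 *: x) = enorm x.
Proof.
by move=> x_gt0; rewrite innerZr -enorm_sqr expr2 mulKf ?gt_eqF.
Qed.

(** Expanding the square yields both Cauchy-Schwarz, as the left side is nonnegative, and its
    equality case, as it vanishes only for [w = enorm w *: z]. Scaling [z] rather than normalizing
    [w] avoids a division. *)
Lemma enorm_defect {m} (w z : 'cV[R]_m) : enorm z = 1 ->
  enorm (w - enorm w *: z) ^+ 2 = 2 * enorm w * (enorm w - inner w z).
Proof.
move=> z1; have ww := enorm_sqr w; have zz := enorm_sqr z.
rewrite z1 expr1n in zz.
have -> : enorm (w - enorm w *: z) ^+ 2 =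
    inner w w - 2 * enorm w * inner w z + enorm w ^+ 2 * inner z z.
  rewrite enorm_sqr /inner !mulr_sumr -sumrB -big_split /=.
  by apply: eq_bigr => i _; rewrite !mxE; ring.
by rewrite -ww -zz; ring.
Qed.

Lemma inner_le_enorm {m} (w z : 'cV[R]_m) : enorm z = 1 -> inner w z <= enorm w.
Proof.
(* The factor [2 * enorm w] of the defect can be cancelled only for nonzero [w]. *)
move=> z1; have := enorm_ge0 w; rewrite le_eqVlt => /predU1P[/esym w0|w_gt0].
  rewrite w0 (enorm_eq0 w0) /inner big1 // => i _.
  by rewrite mxE mul0r.
have := sqr_ge0 (enorm (w - enorm w *: z)).
by rewrite enorm_defect // pmulr_rge0 ?mulr_gt0 // subr_ge0.
Qed.

Lemma inner_eq_enorm {m} {w z : 'cV[R]_m} :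
  enorm z = 1 -> inner w z = enorm w -> w = enorm w *: z.
Proof.
move=> z1 wz; apply/eqP; rewrite -subr_eq0; apply/eqP/enorm_eq0/eqP.
by rewrite -sqrf_eq0 enorm_defect // wz subrr mulr0.
Qed.

(** Termwise, [x i 0 * v i 0] is at most the absolute value of [v i 0], which is what the sign
    attains. *)
Lemma inner_sgnv_le {m} (x v : 'cV[R]_m) :
  (forall i, `|x i 0| <= 1) -> inner x v <= inner (sgnv v) v.
Proof.
move=> x_le1; apply: ler_sum => i _; rewrite mxE -normrEsg.
by apply: le_trans (ler_norm _) _; rewrite normrM ler_piMl.
Qed.

Lemma sgnv_norm_le1 {m} (v : 'cV[R]_m) i : `|sgnv v i 0| <= 1.
Proof. by rewrite mxE normr_sg lern1 leq_b1. Qed.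

(** The inner product is the $L_1$-norm of [v]. *)
Lemma sgnv_inner_eq0 {m} (v : 'cV[R]_m) : inner (sgnv v) v = 0 -> v = 0.
Proof.
move/eqP; rewrite psumr_eq0 => [/allP v0|i _]; last first.
  by rewrite mxE -normrEsg.
apply/colP => i; have := v0 i (mem_index_enum i).
by rewrite /= mxE -normrEsg normr_eq0 mxE => /eqP.
Qed.

Lemma sgnv_l1_subdiff {m} (v : 'cV[R]_m) : l1_subdiff v (sgnv v).
Proof.
by move=> i; case: ifP => _; [rewrite mxE | rewrite -ler_norml sgnv_norm_le1].
Qed.

(* Sign vectors factor through a finite type, so they take finitely many
   values even though their entries live in [R]. *)
Definition sign_code {m} (v : 'cV[R]_m) : 'cV[bool * bool]_m :=
  map_mx (fun x => (0 < x, x < 0)) v.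

Definition sign_decode {m} (c : 'cV[bool * bool]_m) : 'cV[R]_m :=
  map_mx (fun b : bool * bool => b.1%:R - b.2%:R) c.

Lemma sign_codeK {m} (v : 'cV[R]_m) : sign_decode (sign_code v) = sgnv v.
Proof.
apply/colP => i; rewrite !mxE /=.
by case: (sgrP (v i 0)) => _; rewrite ?subrr ?subr0 ?sub0r.
Qed.

End Euclidean.

Theorem theorem3p2 (R : realType) (d n : nat) (X : 'M[R]_(d, n))
    (u : nat -> 'cV[R]_d) (s : nat -> 'cV[R]_n)
    (u0_unit : enorm (u 0%N) = 1)
    (Xu0_neq0 : X^T *m u 0%N <> 0)
    (s_def : forall k : nat, s k = sgnv (X^T *m u k))
    (u_def : forall k : nat, u k.+1 = (enorm (X *m s k))^-1 *: (X *m s k)) :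
  exists (k0 : nat) (ustar : 'cV[R]_d),
    [/\ enorm ustar = 1,
        forall k : nat, (k0 <= k)%N -> u k = ustar
      & FOC_point X ustar].
Proof.
pose N k := enorm (X *m s k).
(* Since the inverse of 0 is 0, a vanishing [N k] would make [u k.+1] zero. The next facts therefore
   assume [0 < N k]; [N_gt0] discharges this by an induction that itself uses [N_le]. *)
have u_unit k : 0 < N k -> enorm (u k.+1) = 1.
  by rewrite u_def; exact: enorm_normalize.
have N_le_inner k : 0 < N k -> N k <= inner (X *m s k.+1) (u k.+1).
  move=> Nk_gt0; rewrite -{1}[N k](inner_normalize _ Nk_gt0) -u_def.
  rewrite !inner_mulmx (s_def k.+1); apply: inner_sgnv_le => i.
  by rewrite s_def sgnv_norm_le1.
have N_le k : 0 < N k -> N k <= N k.+1.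
  move=> Nk_gt0; apply: le_trans (N_le_inner k Nk_gt0) _.
  exact/inner_le_enorm/u_unit.
have N_gt0 k : 0 < N k.
  elim: k => [|k IHk]; last exact: lt_le_trans IHk (N_le k IHk).
  (* Base case: if [X *m s 0] vanished, so would [<X s_0, u_0> = <s_0, X^T u_0>], the $L_1$-norm of
     [X^T *m u 0]. *)
  rewrite lt_def enorm_ge0 andbT; apply/eqP => /enorm_eq0 Xs0.
  apply/Xu0_neq0/sgnv_inner_eq0; rewrite -s_def -inner_mulmx Xs0.
  by rewrite /inner big1 // => i _; rewrite mxE mul0r.
pose F c := enorm (X *m sign_decode c).
pose g k := sign_code (X^T *m u k).
have FgE k : F (g k) = N k by rewrite /F sign_codeK -s_def.
have [|k] := monotone_finite_stalls F g.
  by move=> k; rewrite !FgE N_le.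
rewrite !FgE => N_stall.
(* The stall collapses the chain [N k <= <X s_{k+1}, u_{k+1}> <= N k.+1] to equalities. *)
have innerE : inner (X *m s k.+1) (u k.+1) = enorm (X *m s k.+1).
  apply/le_anti; rewrite inner_le_enorm ?u_unit //=.
  by rewrite -/(N k.+1) N_stall N_le_inner.
have XsE := inner_eq_enorm (u_unit k (N_gt0 k)) innerE.
have u_fix : u k.+2 = u k.+1.
  by rewrite u_def {2}XsE scalerA mulVf ?scale1r // gt_eqF // N_gt0.
exists k.+1, (u k.+1); split; first exact: u_unit.
  (* Each iterate is determined by its predecessor, so the fixed point persists; the induction is on
     the distance from [k.+1]. *)
  move=> j /subnK <-; elim: (j - k.+1)%N => // i IHi.
  by rewrite addSn u_def s_def IHi -s_def -u_def.
split; first exact: u_unit.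
exists (X *m s k.+1).
  by exists (s k.+1) => //; rewrite s_def; exact: sgnv_l1_subdiff.
(* For [w = X *m s k.+1], [u k.+1] attains the Cauchy-Schwarz bound [enorm w], which no unit [z]
   exceeds. *)
by move=> z z1; rewrite innerBr innerE subr_ge0 inner_le_enorm.
Qed.
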